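(* Let $\mathbb{F}$ be a field with a surjective real valuation $v:\mathbb{F}\to\mathbb{R}\cup\{+\infty\}$, $\tau=-v$, $V=\mathbb{F}^n$. Let $\mathcal{E}=(e_1,\dots,e_n)$ and $\mathcal{F}=(f_1,\dots,f_n)$ be two bases of $V$, with associated tropical charts $\varphi_{\mathcal{E}},\varphi_{\mathcal{F}}:\mathbb{T}^n\to U^n(\mathbb{F})$. Let $A=(a^i_j),B=(b^i_j)\in GL_n(\mathbb{F})$ be the transition matrices, $e_j=\sum_i a^i_jf_i$ and $f_j=\sum_i b^i_je_i$ for all $j$ (so $A=B^{-1}$), and let $\alpha=(\tau(a^i_j))$ and $\beta=(\tau(b^i_j))$, regarded as tropical linear maps $\mathbb{T}^n\to\mathbb{T}^n$. Let $I=\varphi_{\mathcal{E}}(\mathbb{T}^n)\cap\varphi_{\mathcal{F}}(\mathbb{T}^n)$, $I_{\mathcal{E}}=\varphi_{\mathcal{E}}^{-1}(I)$, $I_{\mathcal{F}}=\varphi_{\mathcal{F}}^{-1}(I)$, and let $\varphi_{\mathcal{F}\mathcal{E}}=\varphi_{\mathcal{F}}^{-1}\circ\varphi_{\mathcal{E}}:I_{\mathcal{E}}\to I_{\mathcal{F}}$ and $\varphi_{\mathcal{E}\mathcal{F}}=\varphi_{\mathcal{E}}^{-1}\circ\varphi_{\mathcal{F}}:I_{\mathcal{F}}\to I_{\mathcal{E}}$ be the transition functions. Then $$I_{\mathcal{F}}=D_{\alpha\beta},\qquad I_{\mathcal{E}}=D_{\beta\alpha},\qquad \varphi_{\mathcal{F}\mathcal{E}}=\alpha|_{I_{\mathcal{E}}},\qquad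 \varphi_{\mathcal{E}\mathcal{F}}=\beta|_{I_{\mathcal{F}}},$$ where $D_{\alpha\beta}=\{x\in\mathbb{T}^n\mid\alpha(\beta(x))=x\}$ and $D_{\beta\alpha}=\{x\in\mathbb{T}^n\mid\beta(\alpha(x))=x\}$ are the inversion domains.
   Context: $\mathbb{T}=\mathbb{R}\cup\{-\infty\}$ with $a\oplus b=\max(a,b)$ and $a\odot b=a+b$ (equal to $-\infty$ if either is $-\infty$); $\tau(0)=-\infty$. A matrix $\alpha=(\alpha^i_j)$ over $\mathbb{T}$ acts on $\mathbb{T}^n$ by $(\alpha(x))^i=\bigoplus_j\alpha^i_j\odot x^j=\max_j(\alpha^i_j+x^j)$. $\mathcal{O}=\{z\in\mathbb{F}:\tau(z)\le0\}$ is the valuation ring. An $\mathcal{O}$-lattice of $V$ is a finitely generated $\mathcal{O}$-submodule of $V$ (of any rank); $U^n(\mathbb{F})$ is the set of all $\mathcal{O}$-lattices of $V=\mathbb{F}^n$. For each $\lambda\in\mathbb{T}$ choose $t_\lambda\in\mathbb{F}$ with $\tau(t_\lambda)=\lambda$ (so $t_{-\infty}=0$). For a basis $\mathcal{E}=(e_1,\dots,e_n)$ of $V$ the tropical chart is $$\varphi_{\mathcal{E}}:\mathbb{T}^n\to U^n(\mathbb{F}),\qquad \varphi_{\mathcal{E}}(y)=\mathrm{Span}_{\mathcal{O}}(t_{y^1}e_1,\dots,t_{y^n}e_n),$$ which is injective and does not depend on the choice of the $t_\lambda$. *)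

(* Defs.v *)
From HB Require Import structures.
From mathcomp Require Import all_boot all_order all_algebra.
From mathcomp Require Import boolp classical_sets functions.
From mathcomp Require Import reals constructive_ereal ereal.

Set Implicit Arguments.
Unset Strict Implicit.
Unset Printing Implicit Defensive.

Import Order.TTheory GRing.Theory Num.Theory.
Local Open Scope classical_set_scope.
Local Open Scope ring_scope.

(* T = R u {-oo}, as the elements of [\bar R] other than +oo. *)
Record tropical (R : realType) : Type :=
  Tropical { trop_val :> \bar R; trop_valP : trop_val != +oo%E }.

Section TropicalSemiring.
Variable R : realType.
Local Notation T := (tropical R).

HB.instance Definition _ := [isSub for @trop_val R].
HB.instance Definition _ := [Choice of tropical R by <:].

Lemma trop_add_subproof (a b : T) : maxe (a : \bar R) (b : \bar R) != +oo%E.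
Proof. by rewrite /maxe; case: ifP => _; apply: trop_valP. Qed.

Lemma trop_mul_subproof (a b : T) : ((a : \bar R) + (b : \bar R))%E != +oo%E.
Proof. by case: a b => [[a||] //= _] [[b||] //= _]. Qed.

Definition trop_add (a b : T) : T := Tropical (trop_add_subproof a b).
Definition trop_mul (a b : T) : T := Tropical (trop_mul_subproof a b).
Definition trop_zero : T := @Tropical R -oo%E isT.
Definition trop_one : T := @Tropical R 0%E isT.

Lemma trop_addA : associative trop_add.
Proof. by move=> a b c; apply: val_inj; rewrite /= maxA. Qed.

Lemma trop_addC : commutative trop_add.
Proof. by move=> a b; apply: val_inj; rewrite /= maxC. Qed.

Lemma trop_add0 : left_id trop_zero trop_add.
Proof. by move=> a; apply: val_inj; rewrite /= maxNye. Qed.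

Lemma trop_mulA : associative trop_mul.
Proof. by move=> a b c; apply: val_inj; rewrite /= addeA. Qed.

Lemma trop_mulC : commutative trop_mul.
Proof. by move=> a b; apply: val_inj; rewrite /= addeC. Qed.

Lemma trop_mul1 : left_id trop_one trop_mul.
Proof. by move=> a; apply: val_inj; rewrite /= add0e. Qed.

Lemma trop_mulDl : left_distributive trop_mul trop_add.
Proof.
by move=> a b c; apply: val_inj; rewrite /= adde_maxl.
Qed.

Lemma trop_mul0 : left_zero trop_zero trop_mul.
Proof. by move=> a; apply: val_inj; rewrite /= addNye. Qed.

Lemma trop_one_neq0 : trop_one != trop_zero.
Proof. by []. Qed.

(* The tropical semiring: the ring operations [+], [*], [0], [1] on
   [tropical R] are max, +, -oo and 0. Hence, for a matrix [alpha] over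
   [tropical R], [alpha *m x] is the tropical action of [alpha] on [x]. *)
HB.instance Definition _ :=
  GRing.isNmodule.Build T trop_addA trop_addC trop_add0.
HB.instance Definition _ :=
  GRing.Nmodule_isComNzSemiRing.Build T
    trop_mulA trop_mulC trop_mul1 trop_mulDl trop_mul0 trop_one_neq0.

Lemma trop_mulmxE (m n : nat) (alpha : 'M[T]_(m, n)) (x : 'cV[T]_n) (i : 'I_m) :
  ((alpha *m x) i 0 : \bar R) =
    \big[maxe/-oo%E]_(j < n) ((alpha i j : \bar R) + (x j 0%R : \bar R))%E.
Proof. by rewrite mxE (big_morph (@trop_val R) (id1 := -oo%E) (op1 := maxe)). Qed.

End TropicalSemiring.

Record real_valuation (F : fieldType) (R : realType) : Type := RealValuation {
  val_fun :> F -> \bar R;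
  val_neqNy : forall x, val_fun x != -oo%E;
  val_eqy : forall x, val_fun x = +oo%E <-> x = 0;
  val_mul : forall x y, val_fun (x * y) = (val_fun x + val_fun y)%E;
  val_add : forall x y,
    (Order.min (val_fun x) (val_fun y) <= val_fun (x + y))%E }.

Section Lattices.
Variables (R : realType) (F : fieldType) (v : real_valuation F R).

Lemma tau_subproof (z : F) : (- v z)%E != +oo%E.
Proof. by move: (val_neqNy v z); case: (v z). Qed.

Definition tau (z : F) : tropical R := Tropical (tau_subproof z).

Definition val_ring : set F := [set z | ((tau z : \bar R) <= 0)%E].

Variable n : nat.
Local Notation V := 'cV[F]_n.

Definition is_submodule (L : set V) : Prop :=
  [/\ L 0,
      forall x y, L x -> L y -> L (x + y) &
      forall c x, val_ring c -> L x -> L (c *: x)].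

Definition spanO (m : nat) (g : 'I_m -> V) : set V :=
  [set x | exists2 c : 'I_m -> F,
     (forall i, val_ring (c i)) & x = \sum_(i < m) c i *: g i].

Definition is_lattice (L : set V) : Prop :=
  is_submodule L /\ exists (m : nat) (g : 'I_m -> V), L = spanO g.

Record lattice : Type :=
  Lattice { lattice_set :> set V; latticeP : is_lattice lattice_set }.

Lemma val_ringE (z : F) : val_ring z <-> (0 <= v z)%E.
Proof. by rewrite /val_ring /= oppe_le0. Qed.

Lemma spanO_lattice (m : nat) (g : 'I_m -> V) : is_lattice (spanO g).
Proof.
split; last by exists m, g.
split.
- exists (fun=> 0); last by rewrite big1 // => i _; rewrite scale0r.
  by move=> i; apply/val_ringE; rewrite (proj2 (val_eqy v 0)).
- move=> x y [c cO ->] [d dO ->]; exists (fun i => c i + d i).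
    move=> i; apply/val_ringE; apply: le_trans (val_add v (c i) (d i)).
    by rewrite le_min; apply/andP; split; apply/val_ringE.
  by rewrite -big_split; apply: eq_bigr => i _; rewrite scalerDl.
- move=> a x aO [c cO ->]; exists (fun i => a * c i).
    by move=> i; apply/val_ringE; rewrite val_mul adde_ge0 //; apply/val_ringE.
  by rewrite scaler_sumr; apply: eq_bigr => i _; rewrite scalerA.
Qed.

(* [t] is the choice of elements t_lambda with tau t_lambda = lambda. *)
Definition chart (t : tropical R -> F) (e : n.-tuple V)
    (y : 'cV[tropical R]_n) : lattice :=
  Lattice (spanO_lattice (fun i => t (y i 0) *: tnth e i)).

End Lattices.

Definition inversion_domain (R : realType) (n : nat)
    (alpha beta : 'M[tropical R]_n) : set 'cV[tropical R]_n :=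
  [set x | alpha *m (beta *m x) = x].

(* phi_F^-1 \o phi_E. A chart of a basis is injective, so the partial inverse
   of phi_F is its inverse on the range of phi_F; the default value 0 is only
   taken outside of that range, hence outside of the domain of the transition
   function. *)
Definition transition (R : realType) (F : fieldType) (v : real_valuation F R)
    (n : nat) (phiF phiE : 'cV[tropical R]_n -> lattice v n) :
    'cV[tropical R]_n -> 'cV[tropical R]_n :=
  'pinv_(fun=> 0) setT phiF \o phiE.

(* Main.v *)
(* Comparing coordinates, phi_E(x) is contained in phi_F(y) iff
   alpha(x) <= y componentwise, so phi_E(x) = phi_F(y) iff alpha(x) <= y and
   beta(y) <= x. The ultrametric inequality applied to B A = 1 gives
   x <= beta(alpha(x)), hence x <= beta(alpha(x)) <= beta(y) <= x; thus
   phi_E(x) = phi_F(y) forces x = beta(y) and, symmetrically, y = alpha(x).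
   Conversely, if beta(alpha(x)) = x then y = alpha(x) satisfies both
   inequalities. *)
Require Import Defs.
From HB Require Import structures.
From mathcomp Require Import all_boot all_order all_algebra.
From mathcomp Require Import boolp classical_sets functions.
From mathcomp Require Import reals constructive_ereal ereal.

Set Implicit Arguments.
Unset Strict Implicit.
Unset Printing Implicit Defensive.

Import Order.TTheory GRing.Theory Num.Theory.
Local Open Scope classical_set_scope.
Local Open Scope ring_scope.

(** * The entrywise order on tropical matrices *)

Section TropicalOrder.
Variable R : realType.
Local Notation T := (tropical R).

Lemma trop_sum_leP (I : finType) (F : I -> T) (u : \bar R) :
  ((\sum_i F i)%R <= u)%E <-> forall i, (F i <= u)%E.
Proof.
rewrite (big_morph (@trop_val R) (id1 := -oo%E) (op1 := maxe)) //.
split=> [/bigmax_leP[_ Fu] i|Fu]; first exact: Fu.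
by apply/bigmax_leP; split=> [|i _] //; rewrite leNye.
Qed.

Lemma trop_sum_ge (I : finType) (F : I -> T) (i : I) :
  (F i <= (\sum_i F i)%R)%E.
Proof. by have /trop_sum_leP := lexx (trop_val (\sum_i F i)). Qed.

(** The natural order of an idempotent semiring: it amounts to [X + Y = Y]. *)
Definition trop_mxle (m n : nat) (X Y : 'M[T]_(m, n)) : Prop :=
  forall i j, (X i j <= Y i j)%E.

Lemma trop_mxle_refl (m n : nat) (X : 'M[T]_(m, n)) : trop_mxle X X.
Proof. by move=> i j. Qed.

Lemma trop_mxle_trans (m n : nat) (Y X Z : 'M[T]_(m, n)) :
  trop_mxle X Y -> trop_mxle Y Z -> trop_mxle X Z.
Proof. by move=> XY YZ i j; apply: le_trans (XY i j) (YZ i j). Qed.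

Lemma trop_mxle_anti (m n : nat) (X Y : 'M[T]_(m, n)) :
  trop_mxle X Y -> trop_mxle Y X -> X = Y.
Proof.
move=> XY YX; apply/matrixP => i j; apply: val_inj; apply: le_anti.
by apply/andP; split; [exact: XY|exact: YX].
Qed.

(** A tropical sum is a maximum, so bounding an entry of a product means bounding each of its
    terms. *)
Lemma trop_mulmx_leP (m n p : nat) (X : 'M[T]_(m, n)) (Y : 'M[T]_(n, p))
    (Z : 'M[T]_(m, p)) :
  trop_mxle (X *m Y) Z <-> forall i j k, (X i j + Y j k <= Z i k)%E.
Proof.
split=> [XYZ i j k|XYZ i k].
  apply: le_trans (XYZ i k); rewrite mxE.
  exact: (trop_sum_ge (fun j => X i j * Y j k)).
by rewrite mxE; apply/trop_sum_leP => j; exact: XYZ.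
Qed.

Lemma trop_mulmx_ge (m n p : nat) (X : 'M[T]_(m, n)) (Y : 'M[T]_(n, p)) i j k :
  (X i j + Y j k <= (X *m Y)%R i k)%E.
Proof. by have /trop_mulmx_leP := trop_mxle_refl (X *m Y); exact. Qed.

Lemma trop_mxleM (m n p : nat) (X X' : 'M[T]_(m, n)) (Y Y' : 'M[T]_(n, p)) :
  trop_mxle X X' -> trop_mxle Y Y' -> trop_mxle (X *m Y) (X' *m Y').
Proof.
move=> XX' YY'; apply/trop_mulmx_leP => i j k.
apply: le_trans (trop_mulmx_ge X' Y' i j k).
exact: leeD (XX' i j) (YY' j k).
Qed.

End TropicalOrder.

(** * Tropicalization of scalars and matrices *)

Section Valuation.
Variables (R : realType) (F : fieldType) (v : real_valuation F R).

Lemma tau_eq0 (z : F) : (tau v z : \bar R) = -oo%E <-> z = 0.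
Proof.
by split=> [/= /eqP|/(val_eqy v z)/= ->//]; rewrite eqe_oppLR => /eqP/val_eqy.
Qed.

Lemma tauM (x y : F) : tau v (x * y) = tau v x * tau v y.
Proof.
apply: val_inj; rewrite /= val_mul.
have := val_neqNy v x; have := val_neqNy v y.
by case: (v x) => [a||]; case: (v y) => [b||] //= _ _; rewrite opprD.
Qed.

Lemma tau1 : tau v 1 = 1.
Proof.
apply: val_inj => /=.
(* As 1 is nonzero, [v 1] is finite, and [v 1 = v 1 + v 1] then forces it to be 0. *)
have := val_mul v 1 1; rewrite mulr1.
have := val_neqNy v 1; have [+ _] := val_eqy v 1.
case: (v 1) => [a _ _ [/eqP]||] //; last by move=> /(_ erefl)/eqP; rewrite oner_eq0.
by rewrite -subr_eq0 opprD addrA subrr sub0r oppr_eq0 => /eqP ->; rewrite oppe0.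
Qed.

Lemma tau0 : tau v 0 = 0.
Proof. by apply: val_inj; apply/tau_eq0. Qed.

Lemma tauD (x y : F) : (tau v (x + y)%R <= (tau v x + tau v y)%R)%E.
Proof.
rewrite /= leeNl oppe_max !oppeK; exact: val_add.
Qed.

Lemma tau_sum (I : finType) (z : I -> F) :
  (tau v (\sum_i z i)%R <= (\sum_i tau v (z i))%R)%E.
Proof.
elim/big_rec2: _ => [|i y x _ yx]; first by rewrite tau0.
apply: le_trans (tauD _ _) _.
rewrite /= ge_max !le_max lexx /=; apply/orP; right; exact: yx.
Qed.

(** Each term of an entry is tropicalized exactly, but cancellation in the sum can lower the value;
    hence only an inequality. *)
Lemma tau_mulmx (m n p : nat) (X : 'M[F]_(m, n)) (Y : 'M[F]_(n, p)) :
  trop_mxle (map_mx (tau v) (X *m Y)) (map_mx (tau v) X *m map_mx (tau v) Y).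
Proof.
move=> i k; rewrite !mxE; apply: le_trans (tau_sum _) _.
apply/trop_sum_leP => j; apply: le_trans (trop_sum_ge _ j).
by rewrite tauM !mxE.
Qed.

Lemma tau_mx1 (n : nat) : map_mx (tau v) 1%:M = 1%:M :> 'M_n.
Proof.
by apply/matrixP => i j; rewrite !mxE; case: (i == j); rewrite ?tau1 ?tau0.
Qed.

(** Tropicalizing [B *m A = 1] bounds the tropical identity by the product of the tropicalizations,
    and multiplication by [x] is monotone. *)
Lemma trop_mulmx_inv_ge (n m : nat) (A B : 'M[F]_n) (x : 'M[tropical R]_(n, m)) :
  B *m A = 1%:M -> trop_mxle x (map_mx (tau v) B *m (map_mx (tau v) A *m x)).
Proof.
move=> BA; rewrite mulmxA -{1}[x]mul1mx -tau_mx1 -BA.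
exact: trop_mxleM (tau_mulmx B A) (trop_mxle_refl x).
Qed.

End Valuation.

(** * Chart lattices in coordinates *)

Section Charts.
Variables (R : realType) (F : fieldType) (v : real_valuation F R).
Variables (t : tropical R -> F) (tauK : forall l, tau v (t l) = l).
Variable n : nat.
Local Notation V := 'cV[F]_n.
Implicit Types (e f : n.-tuple V) (x y : 'cV[tropical R]_n).

Lemma coordZ e i a (z : V) : coord e i (a *: z) = a * coord e i z.
Proof. by rewrite linearZ. Qed.

Lemma coord_sum_tnth e (c : 'I_n -> F) i :
  basis_of fullv e -> coord e i (\sum_j c j *: tnth e j) = c i.
Proof.
move=> /basis_free e_free.
by under eq_bigr do rewrite (tnth_nth 0); exact: coord_sum_free.
Qed.

Lemma coord_basis_tnth e (z : V) :
  basis_of fullv e -> z = \sum_i coord e i z *: tnth e i.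
Proof.
move=> e_basis; under eq_bigr do rewrite (tnth_nth 0).
by rewrite -(coord_basis e_basis) ?memvf.
Qed.

Lemma coord_transition e f (A : 'M[F]_n) (z : V) i :
    basis_of fullv e -> basis_of fullv f ->
    (forall j, tnth e j = \sum_i A i j *: tnth f i) ->
  coord f i z = \sum_j A i j * coord e j z.
Proof.
move=> e_basis f_basis eA; rewrite [in LHS](coord_basis_tnth z e_basis).
rewrite linear_sum /=; apply: eq_bigr => j _.
by rewrite coordZ eA coord_sum_tnth // mulrC.
Qed.

(** The generators are multiples of basis vectors, so membership constrains each coordinate
    separately. *)
Lemma chartP e y (z : V) : basis_of fullv e ->
  (chart v t e y : set V) z <-> forall i, (tau v (coord e i z) <= y i 0%R)%E.
Proof.
move=> e_basis; split=> [[c cO ->] i|zy].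
  under eq_bigr do rewrite scalerA.
  rewrite coord_sum_tnth // tauM tauK -[leRHS]add0e.
  exact: leeD (cO i) (lexx _).
(* Where [t (y i 0)] is 0, the convention that 0 has inverse 0 makes this coefficient 0. *)
exists (fun i => coord e i z / t (y i 0)) => [i|].
  change (tau v (coord e i z / t (y i 0%R))%R <= 0)%E.
  have [ty0|ty_neq0] := eqVneq (t (y i 0)) 0.
    by rewrite ty0 invr0 mulr0 tau0 leNye.
  (* Finiteness allows [y i 0] to be cancelled from both sides of the inequality. *)
  have yfin : (y i 0 : \bar R) \is a fin_num.
    have ty : (tau v (t (y i 0)) : \bar R) <> -oo%E.
      by move/tau_eq0/eqP; rewrite (negPf ty_neq0).
    rewrite tauK in ty; rewrite fin_numE trop_valP andbT; exact/eqP.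
  rewrite -(leeD2rE _ _ yfin) add0e.
  by have := zy i; rewrite -{1}[coord e i z](divfK ty_neq0) tauM tauK.
rewrite {1}(coord_basis_tnth z e_basis); apply: eq_bigr => i _.
(* If [t (y i 0)] is 0, then [y i 0] is -oo, so the coordinate of [z] vanishes too. *)
rewrite scalerA; have [ty0|ty_neq0] := eqVneq (t (y i 0)) 0; last by rewrite divfK.
have y0 : (y i 0 : \bar R) = -oo%E by rewrite -[y i 0]tauK; apply/tau_eq0.
have := zy i; rewrite y0 leeNy_eq => /eqP/tau_eq0 ->.
by rewrite !mul0r.
Qed.

(** One direction tests the inclusion on the generators; the other bounds the new coordinates by the
    ultrametric inequality. *)
Lemma chart_subset e f (A : 'M[F]_n) x y :
    basis_of fullv e -> basis_of fullv f ->
    (forall j, tnth e j = \sum_i A i j *: tnth f i) ->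
  (chart v t e x `<=` chart v t f y) <-> trop_mxle (map_mx (tau v) A *m x) y.
Proof.
move=> e_basis f_basis eA; split=> [xy|/trop_mulmx_leP Axy z].
  apply/trop_mulmx_leP => i j k; rewrite (ord1 k) !mxE.
  (* The [i]-th coordinate of this generator in [f] is [A i j * t (x j 0)], whose [tau] is the term
     to be bounded. *)
  have /xy/(chartP _ _ f_basis)/(_ i) :
      (chart v t e x : set V) (t (x j 0) *: tnth e j).
    apply/(chartP _ _ e_basis) => l; rewrite coordZ (tnth_nth 0).
    rewrite coord_free ?(basis_free e_basis) //.
    have [->|_] := eqVneq j l; first by rewrite mulr1 tauK.
    by rewrite mulr0 tau0 leNye.
  by rewrite coordZ eA coord_sum_tnth // tauM tauK [in X in X -> _]mulrC.
move=> /(chartP _ _ e_basis) zx; apply/(chartP _ _ f_basis) => i.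
rewrite (coord_transition z i e_basis f_basis eA).
apply: le_trans (tau_sum _ _) _; apply/trop_sum_leP => j; rewrite tauM.
apply: le_trans (Axy i j 0); rewrite mxE; exact: leeD (lexx _) (zx j).
Qed.

Lemma lattice_inj (L M : lattice v n) :
  lattice_set L = lattice_set M -> L = M.
Proof.
case: L M => [L Llat] [M Mlat] /= LM.
by case: _ / LM in Mlat *; rewrite (Prop_irrelevance Llat Mlat).
Qed.

(** * Equality of chart lattices for two bases *)

Section TwoBases.
Variables (e f : n.-tuple V).
Hypotheses (e_basis : basis_of fullv e) (f_basis : basis_of fullv f).
Variables A B : 'M[F]_n.
Hypotheses (eA : forall j, tnth e j = \sum_i A i j *: tnth f i)
           (fB : forall j, tnth f j = \sum_i B i j *: tnth e i).

Let alpha := map_mx (tau v) A.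
Let beta := map_mx (tau v) B.

(** Entry [(k, j)] of the product is the [k]-th coordinate of [tnth e j] in [e], computed by passing
    through [f]. *)
Lemma transition_mxK : B *m A = 1%:M.
Proof.
apply/matrixP => k j; rewrite !mxE.
transitivity (coord e k (tnth e j)).
  rewrite (coord_transition _ k f_basis e_basis fB); apply: eq_bigr => i _.
  by rewrite eA coord_sum_tnth.
by rewrite (tnth_nth 0) coord_free ?(basis_free e_basis) // eq_sym.
Qed.

Lemma chart_eqP x y :
  chart v t e x = chart v t f y <->
  trop_mxle (alpha *m x) y /\ trop_mxle (beta *m y) x.
Proof.
split=> [exy|[Axy Byx]].
  by split; [apply/(chart_subset _ _ e_basis f_basis eA)
            |apply/(chart_subset _ _ f_basis e_basis fB)]; rewrite exy.
apply: lattice_inj; apply/seteqP; split.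
  exact/(chart_subset _ _ e_basis f_basis eA).
exact/(chart_subset _ _ f_basis e_basis fB).
Qed.

(** Antisymmetry closes the chain of inequalities from [x] back to [x]; exchanging the bases yields
    [alpha *m x = y]. *)
Lemma chart_eq_inv x y : chart v t e x = chart v t f y -> beta *m y = x.
Proof.
move=> /chart_eqP[Axy Byx]; apply: trop_mxle_anti => //.
apply: trop_mxle_trans (trop_mulmx_inv_ge v x transition_mxK) _.
exact: trop_mxleM (@trop_mxle_refl _ _ _ beta) Axy.
Qed.

End TwoBases.

(** * Inversion domains and transition functions *)

Lemma chart_preimage_inversion e f (A B : 'M[F]_n) :
    basis_of fullv e -> basis_of fullv f ->
    (forall j, tnth e j = \sum_i A i j *: tnth f i) ->
    (forall j, tnth f j = \sum_i B i j *: tnth e i) ->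
  chart v t e @^-1` range (chart v t f) =
  inversion_domain (map_mx (tau v) B) (map_mx (tau v) A).
Proof.
move=> e_basis f_basis eA fB; apply/seteqP; split=> [x [y _ fy]|x BAx].
  have xy := esym fy; rewrite /inversion_domain /=.
  by rewrite (chart_eq_inv f_basis e_basis fB eA fy)
             (chart_eq_inv e_basis f_basis eA fB xy).
(* For this witness the first inequality of [chart_eqP] is reflexivity, and so is the second after
   rewriting by [BAx]. *)
exists (map_mx (tau v) A *m x) => //; apply/esym.
apply/(chart_eqP e_basis f_basis eA fB); rewrite BAx.
by split; exact: trop_mxle_refl.
Qed.

(** On the range of the chart of [f], the partial inverse returns a preimage, and [chart_eq_inv]
    with the bases exchanged identifies it. *)
Lemma transition_chart e f (A B : 'M[F]_n) x :
    basis_of fullv e -> basis_of fullv f ->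
    (forall j, tnth e j = \sum_i A i j *: tnth f i) ->
    (forall j, tnth f j = \sum_i B i j *: tnth e i) ->
    range (chart v t f) (chart v t e x) ->
  transition (chart v t f) (chart v t e) x = map_mx (tau v) A *m x.
Proof.
move=> e_basis f_basis eA fB /mem_set fx.
by apply/esym/(chart_eq_inv f_basis e_basis fB eA); apply: pinvK.
Qed.

End Charts.

Theorem theorem4p7 (R : realType) (F : fieldType) (v : real_valuation F R)
    (v_surj : forall l : \bar R, l != -oo%E -> exists z : F, v z = l)
    (t : tropical R -> F) (tauK : forall l : tropical R, tau v (t l) = l)
    (n : nat) (e f : n.-tuple 'cV[F]_n)
    (e_basis : basis_of fullv e) (f_basis : basis_of fullv f)
    (A B : 'M[F]_n) (A_unit : A \in unitmx) (B_unit : B \in unitmx)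
    (eA : forall j : 'I_n, tnth e j = \sum_(i < n) A i j *: tnth f i)
    (fB : forall j : 'I_n, tnth f j = \sum_(i < n) B i j *: tnth e i) :
  let alpha : 'M[tropical R]_n := map_mx (tau v) A in
  let beta : 'M[tropical R]_n := map_mx (tau v) B in
  let phiE := chart v t e in
  let phiF := chart v t f in
  let I := range phiE `&` range phiF in
  let I_E := phiE @^-1` I in
  let I_F := phiF @^-1` I in
  [/\ I_F = inversion_domain alpha beta,
      I_E = inversion_domain beta alpha,
      {in I_E, transition phiF phiE =1 (fun x => alpha *m x)} &
      {in I_F, transition phiE phiF =1 (fun x => beta *m x)}].
Proof.
move=> alpha beta phiE phiF I I_E I_F.
(* Every value of [phiF] lies in its own range, so only membership in the range of [phiE]
   remains. *)
have I_FE : I_F = phiF @^-1` range phiE.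
  by rewrite /I_F preimage_setI preimage_range setIT.
have I_EF : I_E = phiE @^-1` range phiF.
  by rewrite /I_E preimage_setI preimage_range setTI.
split.
- by rewrite I_FE (chart_preimage_inversion tauK f_basis e_basis fB eA).
- by rewrite I_EF (chart_preimage_inversion tauK e_basis f_basis eA fB).
- move=> x; rewrite I_EF => /set_mem.
  exact: (transition_chart tauK e_basis f_basis eA fB).
- move=> y; rewrite I_FE => /set_mem.
  exact: (transition_chart tauK f_basis e_basis fB eA).
Qed.
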